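(* Let $\mathcal{G}$ be a hyper-environment. If there is an HCP term $P$ with $\vdash P:\mathcal{G}$ in HCP, then there is a CP term $Q$ and a channel name $z$ with $\vdash Q: z:\bigotimes\mathcal{G}$ in CP, where $\bigotimes\varnothing=\mathbf{1}$ and $\bigotimes(\Gamma_1\mid\dots\mid\Gamma_n)=⅋\Gamma_1\otimes\dots\otimes⅋\Gamma_n$ for $n\ge1$, with $⅋(\cdot)=\bot$ for the empty environment and $⅋(x_1:A_1,\dots,x_k:A_k)=A_1⅋\dots⅋A_k$ for $k\ge1$.
   Context: Session types: $A,B ::= A\otimes B \mid \mathbf{1} \mid A ⅋ B \mid \bot \mid A\oplus B \mid \mathbf{0} \mid A \& B \mid \top$, with duality the involution $(A\otimes B)^\bot = A^\bot ⅋ B^\bot$, $(A ⅋ B)^\bot = A^\bot\otimes B^\bot$, $\mathbf{1}^\bot=\bot$, $\bot^\bot=\mathbf{1}$, $(A\oplus B)^\bot = A^\bot \& B^\bot$, $(A\& B)^\bot = A^\bot\oplus B^\bot$, $\mathbf{0}^\bot=\top$, $\top^\bot=\mathbf{0}$. An environment is a finite list $x_1:A_1,\dots,x_n:A_n$ of pairwise distinct names with types; $\Gamma,\Delta$ requires disjoint names. A hyper-environment is a finite multiset $\Gamma_1\mid\dots\mid\Gamma_n$ of environments (empty: $\varnothing$); names may be shared between its environments. Iterated $\otimes$ and $⅋$ are read as associated to the right. CP terms: $P,Q ::= x\leftrightarrow y \mid \nu x(P\parallel Q)$ (cut; $x$ bound in $P$ and $Q$) $\mid x[y](P\parallel Q)$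 (output; $y$ bound in $P$, $x$ continues in $Q$) $\mid x(y).P$ ($y$ bound in $P$) $\mid x[].0 \mid x().P \mid x\triangleleft\mathrm{inl}.P\mid x\triangleleft\mathrm{inr}.P\mid x\triangleright\{\mathrm{inl}:P;\mathrm{inr}:Q\}\mid x\triangleright\{\}$. CP typing $\vdash P:\Gamma$: (Ax) $\vdash x\leftrightarrow y:x:A,y:A^\bot$; (Cut) from $\vdash P:\Gamma,x:A$ and $\vdash Q:\Delta,x:A^\bot$ infer $\vdash \nu x(P\parallel Q):\Gamma,\Delta$; ($\otimes$) from $\vdash P:\Gamma,y:A$ and $\vdash Q:\Delta,x:B$ infer $\vdash x[y](P\parallel Q):\Gamma,\Delta,x:A\otimes B$; ($⅋$) from $\vdash P:\Gamma,y:A,x:B$ infer $\vdash x(y).P:\Gamma,x:A⅋B$; ($\mathbf{1}$) $\vdash x[].0:x:\mathbf{1}$; ($\bot$) from $\vdash P:\Gamma$ infer $\vdash x().P:\Gamma,x:\bot$; ($\oplus_1$) from $\vdash P:\Gamma,x:A$ infer $\vdash x\triangleleft\mathrm{inl}.P:\Gamma,x:A\oplus B$; ($\oplus_2$) from $\vdash P:\Gamma,x:B$ infer $\vdash x\triangleleft\mathrm{inr}.P:\Gamma,x:A\oplus B$; ($\&$) from $\vdash P:\Gamma,x:A$ and $\vdash Q:\Gamma,x:B$ infer $\vdash x\triangleright\{\mathrm{inl}:P;\mathrm{inr}:Q\}:\Gamma,x:A\&B$; ($\top$) $\vdash x\triangleright\{\}:\Gamma,x:\top$; no rule for $\mathbf{0}$.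 HCP terms: $P,Q,R ::= x\leftrightarrow y \mid 0 \mid (\nu x)P$ (binds $x$) $\mid (P \mid Q) \mid x[y].P$ ($y$ bound in $P$) $\mid x(y).P$ ($y$ bound in $P$) $\mid x[].P \mid x().P \mid x\triangleleft \mathrm{inl}.P \mid x\triangleleft\mathrm{inr}.P \mid x\triangleright\{\mathrm{inl}:P;\mathrm{inr}:Q\} \mid x\triangleright\{\}$. HCP typing $\vdash P:\mathcal{G}$: (Ax) $\vdash x\leftrightarrow y : x:A, y:A^\bot$. (H-Cut) from $\vdash P:\mathcal{G}\mid \Gamma, x:A \mid \Delta, x:A^\bot$ infer $\vdash (\nu x)P : \mathcal{G}\mid \Gamma,\Delta$. (H-Mix) from $\vdash P:\mathcal{G}$, $\vdash Q:\mathcal{H}$ infer $\vdash (P\mid Q): \mathcal{G}\mid\mathcal{H}$. (H-Mix$_0$) $\vdash 0:\varnothing$. ($\otimes$) from $\vdash P : \mathcal{G}\mid \Gamma, y:A \mid \Delta, x:B$ infer $\vdash x[y].P : \mathcal{G}\mid\Gamma,\Delta,x:A\otimes B$. ($⅋$) from $\vdash P : \mathcal{G}\mid\Gamma, y:A, x:B$ infer $\vdash x(y).P : \mathcal{G}\mid\Gamma, x:A⅋B$. ($\mathbf{1}$) from $\vdash P:\mathcal{G}$ infer $\vdash x[].P : \mathcal{G}\mid x:\mathbf{1}$. ($\bot$) from $\vdash P:\mathcal{G}\mid\Gamma$ infer $\vdash x().P : \mathcal{G}\mid\Gamma,x:\bot$. ($\oplus_1$) from $\vdash P:\mathcal{G}\mid\Gamma,x:A$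 infer $\vdash x\triangleleft\mathrm{inl}.P:\mathcal{G}\mid\Gamma,x:A\oplus B$; ($\oplus_2$) analogously with $\mathrm{inr}$ and $x:B$. ($\&$) from $\vdash P:\Gamma,x:A$ and $\vdash Q:\Gamma,x:B$ infer $\vdash x\triangleright\{\mathrm{inl}:P;\mathrm{inr}:Q\}:\Gamma,x:A\&B$. ($\top$) $\vdash x\triangleright\{\}:\Gamma,x:\top$. No rule for $\mathbf{0}$. Each logical rule ($\otimes,⅋,\mathbf{1},\bot,\oplus_1,\oplus_2$) has the side condition that $x$ does not occur in $\mathcal{G}$. *)

(* Defs.v *)
From Stdlib Require Import List Permutation.
Import ListNotations.

Inductive ty : Type :=
| Tensor (A B : ty) | One
| Par (A B : ty) | Bot
| Plus (A B : ty) | Zero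
| With (A B : ty) | Top.

Fixpoint dual (A : ty) : ty :=
  match A with
  | Tensor A B => Par (dual A) (dual B)
  | Par A B => Tensor (dual A) (dual B)
  | One => Bot
  | Bot => One
  | Plus A B => With (dual A) (dual B)
  | With A B => Plus (dual A) (dual B)
  | Zero => Top
  | Top => Zero
  end.

Definition name := nat.

(* Lists represent environments up to exchange and hyper-environments as
   multisets: both typing judgments below are closed under permutation. *)
Definition env := list (name * ty).
Definition henv := list env.

Definition names (Gamma : env) : list name := map fst Gamma.

Definition wf_env (Gamma : env) : Prop := NoDup (names Gamma).

(* Distinct environments of a hyper-environment may share names. *)
Definition wf_henv (G : henv) : Prop := Forall wf_env G.

Definition not_in_henv (x : name) (G : henv) : Prop :=
  Forall (fun Gamma => ~ In x (names Gamma)) G.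

(* Terms are raw, with named binders, and are not quotiented by
   alpha-equivalence.  An alpha-class is typable in a given (hyper-)environment
   iff one of its raw representatives is, so statements of the form
   "some term is typable" are unaffected. *)
Inductive cp : Type :=
| cp_link (x y : name)                (* x <-> y *)
| cp_cut (x : name) (P Q : cp)        (* nu x (P || Q), x bound in P and Q *)
| cp_out (x y : name) (P Q : cp)      (* x[y](P || Q), y bound in P only *)
| cp_in (x y : name) (P : cp)         (* x(y).P, y bound in P *)
| cp_close (x : name)                 (* x[].0 *)
| cp_wait (x : name) (P : cp)         (* x().P *)
| cp_inl (x : name) (P : cp)
| cp_inr (x : name) (P : cp)
| cp_case (x : name) (P Q : cp)
| cp_absurd (x : name).               (* x |> {} *)

(* Side conditions [wf_env] appear exactly where well-formedness of the
   conclusion does not follow from that of the premises; for [Gamma ++ Delta]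
   it amounts to disjointness of names. *)
Inductive cp_typed : cp -> env -> Prop :=
| CP_Exch P Gamma Gamma' :
    Permutation Gamma Gamma' ->
    cp_typed P Gamma ->
    cp_typed P Gamma'
| CP_Ax x y A :
    wf_env [(x, A); (y, dual A)] ->
    cp_typed (cp_link x y) [(x, A); (y, dual A)]
| CP_Cut x A P Q Gamma Delta :
    wf_env (Gamma ++ Delta) ->
    cp_typed P ((x, A) :: Gamma) ->
    cp_typed Q ((x, dual A) :: Delta) ->
    cp_typed (cp_cut x P Q) (Gamma ++ Delta)
| CP_Tensor x y A B P Q Gamma Delta :
    wf_env ((x, Tensor A B) :: Gamma ++ Delta) ->
    cp_typed P ((y, A) :: Gamma) ->
    cp_typed Q ((x, B) :: Delta) ->
    cp_typed (cp_out x y P Q) ((x, Tensor A B) :: Gamma ++ Delta)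
| CP_Par x y A B P Gamma :
    cp_typed P ((y, A) :: (x, B) :: Gamma) ->
    cp_typed (cp_in x y P) ((x, Par A B) :: Gamma)
| CP_One x :
    cp_typed (cp_close x) [(x, One)]
| CP_Bot x P Gamma :
    wf_env ((x, Bot) :: Gamma) ->
    cp_typed P Gamma ->
    cp_typed (cp_wait x P) ((x, Bot) :: Gamma)
| CP_Plus1 x A B P Gamma :
    cp_typed P ((x, A) :: Gamma) ->
    cp_typed (cp_inl x P) ((x, Plus A B) :: Gamma)
| CP_Plus2 x A B P Gamma :
    cp_typed P ((x, B) :: Gamma) ->
    cp_typed (cp_inr x P) ((x, Plus A B) :: Gamma)
| CP_With x A B P Q Gamma :
    cp_typed P ((x, A) :: Gamma) ->
    cp_typed Q ((x, B) :: Gamma) ->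
    cp_typed (cp_case x P Q) ((x, With A B) :: Gamma)
| CP_Top x Gamma :
    wf_env ((x, Top) :: Gamma) ->
    cp_typed (cp_absurd x) ((x, Top) :: Gamma).

Inductive hcp : Type :=
| hcp_link (x y : name)               (* x <-> y *)
| hcp_nil                             (* 0 *)
| hcp_nu (x : name) (P : hcp)         (* (nu x)P, x bound in P *)
| hcp_mix (P Q : hcp)                 (* (P | Q) *)
| hcp_out (x y : name) (P : hcp)      (* x[y].P, y bound in P *)
| hcp_in (x y : name) (P : hcp)       (* x(y).P, y bound in P *)
| hcp_close (x : name) (P : hcp)      (* x[].P *)
| hcp_wait (x : name) (P : hcp)       (* x().P *)
| hcp_inl (x : name) (P : hcp)
| hcp_inr (x : name) (P : hcp)
| hcp_case (x : name) (P Q : hcp)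
| hcp_absurd (x : name).              (* x |> {} *)

(* Freshness for the ambient hyper-environment is required only of the subject
   [x] of a logical rule, not of the names bound by [HCP_Cut], [HCP_Tensor] and
   [HCP_Par]. *)
Inductive hcp_typed : hcp -> henv -> Prop :=
| HCP_Exch P G G' :
    Permutation G G' ->
    hcp_typed P G ->
    hcp_typed P G'
| HCP_ExchEnv P Gamma Gamma' G :
    Permutation Gamma Gamma' ->
    hcp_typed P (Gamma :: G) ->
    hcp_typed P (Gamma' :: G)
| HCP_Ax x y A :
    wf_env [(x, A); (y, dual A)] ->
    hcp_typed (hcp_link x y) [[(x, A); (y, dual A)]]
| HCP_Cut x A P Gamma Delta G :
    wf_env (Gamma ++ Delta) ->
    hcp_typed P (((x, A) :: Gamma) :: ((x, dual A) :: Delta) :: G) ->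
    hcp_typed (hcp_nu x P) ((Gamma ++ Delta) :: G)
| HCP_Mix P Q G H :
    hcp_typed P G ->
    hcp_typed Q H ->
    hcp_typed (hcp_mix P Q) (G ++ H)
| HCP_Mix0 :
    hcp_typed hcp_nil []
| HCP_Tensor x y A B P Gamma Delta G :
    wf_env ((x, Tensor A B) :: Gamma ++ Delta) ->
    not_in_henv x G ->
    hcp_typed P (((y, A) :: Gamma) :: ((x, B) :: Delta) :: G) ->
    hcp_typed (hcp_out x y P) (((x, Tensor A B) :: Gamma ++ Delta) :: G)
| HCP_Par x y A B P Gamma G :
    not_in_henv x G ->
    hcp_typed P (((y, A) :: (x, B) :: Gamma) :: G) ->
    hcp_typed (hcp_in x y P) (((x, Par A B) :: Gamma) :: G)
| HCP_One x P G :
    not_in_henv x G ->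
    hcp_typed P G ->
    hcp_typed (hcp_close x P) ([(x, One)] :: G)
| HCP_Bot x P Gamma G :
    wf_env ((x, Bot) :: Gamma) ->
    not_in_henv x G ->
    hcp_typed P (Gamma :: G) ->
    hcp_typed (hcp_wait x P) (((x, Bot) :: Gamma) :: G)
| HCP_Plus1 x A B P Gamma G :
    not_in_henv x G ->
    hcp_typed P (((x, A) :: Gamma) :: G) ->
    hcp_typed (hcp_inl x P) (((x, Plus A B) :: Gamma) :: G)
| HCP_Plus2 x A B P Gamma G :
    not_in_henv x G ->
    hcp_typed P (((x, B) :: Gamma) :: G) ->
    hcp_typed (hcp_inr x P) (((x, Plus A B) :: Gamma) :: G)
| HCP_With x A B P Q Gamma :
    hcp_typed P [(x, A) :: Gamma] ->
    hcp_typed Q [(x, B) :: Gamma] ->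
    hcp_typed (hcp_case x P Q) [(x, With A B) :: Gamma]
| HCP_Top x Gamma :
    wf_env ((x, Top) :: Gamma) ->
    hcp_typed (hcp_absurd x) [(x, Top) :: Gamma].

(* Both iterations depend on the order of the list; units occur only for the
   empty list. *)
Fixpoint big_par (Gamma : env) : ty :=
  match Gamma with
  | [] => Bot
  | [(_, A)] => A
  | (_, A) :: Gamma' => Par A (big_par Gamma')
  end.

Fixpoint big_tensor (G : henv) : ty :=
  match G with
  | [] => One
  | [Gamma] => big_par Gamma
  | Gamma :: G' => Tensor (big_par Gamma) (big_tensor G')
  end.

(* Main.v *)
(* A derivable hyper-environment is derivable componentwise: every HCP rule,
   read on the single environments it touches, is a CP rule (H-Cut becomes Cut,
   H-Mix only collects environments). In CP, ⅋ and ⊥ turn each component Γ_i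
   into ⅋Γ_i, and ⊗ (or 1) joins the results. Bound names never matter because
   provability is stated for sequents of types, under every choice of distinct
   names. *)
Require Import Defs.
From Stdlib Require Import List Permutation Lia.
Import ListNotations.

(* Quantifying over all namings builds renaming into the predicate, so no
   substitution lemma on raw terms is needed. *)
Definition provable (As : list ty) : Prop :=
  forall Gamma, wf_env Gamma -> map snd Gamma = As ->
  exists P, cp_typed P Gamma.

Lemma fresh_name (Gamma : env) : exists y, ~ In y (names Gamma).
Proof.
  exists (S (list_max (names Gamma))). intros Hin.
  assert (Hle := proj1 (list_max_le (names Gamma) _) (le_n _)).
  rewrite Forall_forall in Hle. apply Hle in Hin. lia.
Qed.

Lemma wf_env_cons x A Gamma :
  wf_env ((x, A) :: Gamma) <-> ~ In x (names Gamma) /\ wf_env Gamma.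
Proof. apply NoDup_cons_iff. Qed.

Lemma wf_env_app Gamma Delta :
  wf_env (Gamma ++ Delta) -> wf_env Gamma /\ wf_env Delta.
Proof.
  unfold wf_env, names. rewrite map_app. intros H.
  split; [exact (NoDup_app_remove_r _ _ H) | exact (NoDup_app_remove_l _ _ H)].
Qed.

Lemma in_names_app x Gamma Delta :
  In x (names (Gamma ++ Delta)) <-> In x (names Gamma) \/ In x (names Delta).
Proof. unfold names. rewrite map_app. apply in_app_iff. Qed.

Lemma map_snd_cons (Gamma : env) A As :
  map snd Gamma = A :: As ->
  exists x Gamma', Gamma = (x, A) :: Gamma' /\ map snd Gamma' = As.
Proof.
  destruct Gamma as [|[x B] Gamma']; intros [=]; subst. eauto.
Qed.

(** A permutation of types lifts to one of any environment that names them, so [CP_Exch] applies. *)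
Lemma provable_exch As Bs : Permutation As Bs -> provable As -> provable Bs.
Proof.
  intros HP HA Gamma Hwf <-.
  destruct (Permutation_map_inv _ _ HP) as (Delta & -> & HP').
  destruct (HA Delta) as [P HPt]; auto.
  - unfold wf_env, names. now rewrite <- HP'.
  - exists P. now apply (CP_Exch _ Delta); [symmetry|].
Qed.

Lemma provable_ax A : provable [A; dual A].
Proof.
  intros Gamma Hwf HG.
  destruct (map_snd_cons _ _ _ HG) as (x & G1 & -> & H1).
  destruct (map_snd_cons _ _ _ H1) as (y & G2 & -> & H2).
  apply map_eq_nil in H2 as ->.
  exists (cp_link x y). now constructor.
Qed.

Lemma provable_cut A As Bs :
  provable (A :: As) -> provable (dual A :: Bs) -> provable (As ++ Bs).
Proof.
  intros HA HB Gamma Hwf HG.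
  destruct (map_eq_app _ _ _ _ HG) as (G1 & G2 & -> & <- & <-).
  (* The cut name of the HCP term is forgotten: a new one, fresh for both contexts, can be used
     since the premises hold under every naming. *)
  destruct (fresh_name (G1 ++ G2)) as [x Hx].
  rewrite in_names_app in Hx.
  destruct (wf_env_app _ _ Hwf) as [W1 W2].
  destruct (HA ((x, A) :: G1)) as [P HP]; [rewrite wf_env_cons; tauto | easy |].
  destruct (HB ((x, dual A) :: G2)) as [Q HQ];
    [rewrite wf_env_cons; tauto | easy |].
  exists (cp_cut x P Q). now apply CP_Cut with A.
Qed.

Lemma provable_tensor A B As Bs :
  provable (A :: As) -> provable (B :: Bs) ->
  provable (Tensor A B :: As ++ Bs).
Proof.
  intros HA HB Gamma Hwf HG.
  destruct (map_snd_cons _ _ _ HG) as (x & G & -> & HG').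
  destruct (map_eq_app _ _ _ _ HG') as (G1 & G2 & -> & <- & <-).
  destruct (proj1 (wf_env_cons _ _ _) Hwf) as [Hx W].
  rewrite in_names_app in Hx.
  destruct (wf_env_app _ _ W) as [W1 W2].
  (* [y] is bound in the left process only, so it may clash with [x] or with names of [G2]. *)
  destruct (fresh_name G1) as [y Hy].
  destruct (HA ((y, A) :: G1)) as [P HP]; [rewrite wf_env_cons; tauto | easy |].
  destruct (HB ((x, B) :: G2)) as [Q HQ]; [rewrite wf_env_cons; tauto | easy |].
  exists (cp_out x y P Q). now apply CP_Tensor.
Qed.

Lemma provable_par A B As :
  provable (A :: B :: As) -> provable (Par A B :: As).
Proof.
  intros HA Gamma Hwf HG.
  destruct (map_snd_cons _ _ _ HG) as (x & G & -> & <-).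
  rewrite wf_env_cons in Hwf.
  (* Here [y] and [x] stand in the same premise and must differ. *)
  destruct (fresh_name ((x, B) :: G)) as [y Hy].
  destruct (HA ((y, A) :: (x, B) :: G)) as [P HP];
    [rewrite !wf_env_cons; tauto | easy |].
  exists (cp_in x y P). now constructor.
Qed.

Lemma provable_one : provable [One].
Proof.
  intros Gamma Hwf HG.
  destruct (map_snd_cons _ _ _ HG) as (x & G & -> & H).
  apply map_eq_nil in H as ->.
  exists (cp_close x). constructor.
Qed.

Lemma provable_bot As : provable As -> provable (Bot :: As).
Proof.
  intros HA Gamma Hwf HG.
  destruct (map_snd_cons _ _ _ HG) as (x & G & -> & <-).
  destruct (proj1 (wf_env_cons _ _ _) Hwf) as [_ W].
  destruct (HA G) as [P HP]; auto.
  exists (cp_wait x P). now constructor.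
Qed.

Lemma provable_plus1 A B As : provable (A :: As) -> provable (Plus A B :: As).
Proof.
  intros HA Gamma Hwf HG.
  destruct (map_snd_cons _ _ _ HG) as (x & G & -> & <-).
  destruct (HA ((x, A) :: G)) as [P HP]; auto.
  exists (cp_inl x P). now constructor.
Qed.

Lemma provable_plus2 A B As : provable (B :: As) -> provable (Plus A B :: As).
Proof.
  intros HB Gamma Hwf HG.
  destruct (map_snd_cons _ _ _ HG) as (x & G & -> & <-).
  destruct (HB ((x, B) :: G)) as [P HP]; auto.
  exists (cp_inr x P). now constructor.
Qed.

Lemma provable_with A B As :
  provable (A :: As) -> provable (B :: As) -> provable (With A B :: As).
Proof.
  intros HA HB Gamma Hwf HG.
  destruct (map_snd_cons _ _ _ HG) as (x & G & -> & <-).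
  destruct (HA ((x, A) :: G)) as [P HP]; auto.
  destruct (HB ((x, B) :: G)) as [Q HQ]; auto.
  exists (cp_case x P Q). now constructor.
Qed.

Lemma provable_top As : provable (Top :: As).
Proof.
  intros Gamma Hwf HG.
  destruct (map_snd_cons _ _ _ HG) as (x & G & -> & _).
  exists (cp_absurd x). now constructor.
Qed.

Lemma hcp_typed_provable P G :
  hcp_typed P G -> Forall (fun Gamma => provable (map snd Gamma)) G.
Proof.
  induction 1;
    (* Separates, in each induction hypothesis, the environments on which the rule acts from the
       ambient ones, which carry over unchanged. *)
    repeat match goal with
    | H : Forall _ (_ :: _) |- _ => apply Forall_cons_iff in H as [? H]
    end;
    cbn [map snd] in *.
  - now apply (Permutation_Forall H).
  - constructor; cbn; auto.
    apply (provable_exch (map snd Gamma)); auto using Permutation_map.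
  - constructor; cbn; auto using provable_ax.
  - constructor; cbn; auto. rewrite map_app. eauto using provable_cut.
  - now apply Forall_app.
  - constructor.
  - constructor; cbn; auto. rewrite map_app. auto using provable_tensor.
  - constructor; cbn; auto using provable_par.
  - constructor; cbn; auto using provable_one.
  - constructor; cbn; auto using provable_bot.
  - constructor; cbn; auto using provable_plus1.
  - constructor; cbn; auto using provable_plus2.
  - constructor; cbn; auto using provable_with.
  - constructor; cbn; auto using provable_top.
Qed.

(* The context [As] collects the entries of the environment still to be
   processed: the right-nested par is built from its last argument. *)
Lemma provable_big_par Gamma As :
  provable (map snd Gamma ++ As) -> provable (big_par Gamma :: As).
Proof.
  revert As. induction Gamma as [|[x A] [|b Gamma] IH]; intros As H.
  - now apply provable_bot.
  - exact H.
  - apply provable_par.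
    (* The head [A] is parked in the context while the induction hypothesis, at [A :: As], folds the
       tail. *)
    apply (provable_exch (big_par (b :: Gamma) :: A :: As)); [constructor|].
    apply IH. revert H. apply provable_exch, Permutation_middle.
Qed.

Lemma provable_big_tensor G :
  Forall (fun Gamma => provable (map snd Gamma)) G -> provable [big_tensor G].
Proof.
  induction 1 as [|Gamma [|Delta G] H _ IH].
  - exact provable_one.
  - apply provable_big_par. now rewrite app_nil_r.
  - apply (provable_tensor _ _ [] []); [|exact IH].
    apply provable_big_par. now rewrite app_nil_r.
Qed.

Theorem theorem37 (G : henv) (hG : wf_henv G) :
  (exists P : hcp, hcp_typed P G) ->
  exists (Q : cp) (z : name), cp_typed Q [(z, big_tensor G)].
Proof.
  intros [P HP].
  (* Any name can serve as [z]; [0] is an arbitrary choice. *)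
  destruct (provable_big_tensor G (hcp_typed_provable P G HP)
              [(0, big_tensor G)]) as [Q HQ].
  - repeat constructor. easy.
  - easy.
  - now exists Q, 0.
Qed.
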